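(* Let $\hat{\mathbb{P}}_1,\dots,\hat{\mathbb{P}}_N$ be empirical (finitely supported) probability distributions on $\Xi$, let $\beta>0$, let $L:\Theta\times\Xi\to\mathbb{R}$ be a loss function, $c:\Xi\times\Xi\to[0,\infty)$ a transportation cost, and fix $\theta\in\Theta$, $\rho>0$ and $\lambda\in\mathbb{R}^N$ with $\lambda_i\ge0$, $\sum_{i=1}^N\lambda_i=1$. Put $\hat{\mathbb{P}}_\lambda=\sum_{i=1}^N\lambda_i\hat{\mathbb{P}}_i$. Let $$\mathbb{P}^*_\lambda\in\arg\max_{\mathbb{P}\in\mathcal{P}(\Xi)}\big\{\mathbb{E}_{\xi\sim\mathbb{P}}[L(\theta,\xi)]-\rho\,\mathrm{UW}(\mathbb{P}\,\|\,\hat{\mathbb{P}}_\lambda)\big\}$$ be a maximizer and define $\hat r_\lambda=\mathrm{UW}(\mathbb{P}^*_\lambda\,\|\,\hat{\mathbb{P}}_\lambda)$. Then $$\sup_{\mathbb{P}:\ \mathrm{UW}(\mathbb{P}\|\hat{\mathbb{P}}_\lambda)\le\hat r_\lambda}\mathbb{E}_{\xi\sim\mathbb{P}}[L(\theta,\xi)]\ \le\ \rho\hat r_\lambda+\rho\beta\log\mathbb{E}_{\zeta\sim\hat{\mathbb{P}}_\lambda}\big[e^{f(\theta,\zeta)/(\rho\beta)}\big]\ =\ \mathbb{E}_{\xi\sim\mathbb{P}^*_\lambda}[L(\theta,\xi)],$$ where $f(\theta,\zeta)=\sup_{\xi\in\Xi}\{L(\theta,\xi)-\rho c(\xi,\z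eta)\}$.
   Context: $\mathcal{P}(\Xi)$ is the set of probability distributions on the measurable space $\Xi$; $L(\theta,\cdot)$ and $c$ are measurable. For $\mathbb{P},\hat{\mathbb{P}}\in\mathcal{P}(\Xi)$ the unbalanced Wasserstein distance is $$\mathrm{UW}(\mathbb{P}\,\|\,\hat{\mathbb{P}})=\inf_{\bar{\mathbb{P}}\in\mathcal{P}(\Xi),\ \gamma\in\Gamma(\mathbb{P},\bar{\mathbb{P}})}\Big\{\mathbb{E}_{(\xi,\zeta)\sim\gamma}[c(\xi,\zeta)]+\beta\,\mathrm{D_{KL}}(\bar{\mathbb{P}}\,\|\,\hat{\mathbb{P}})\Big\},$$ where $\Gamma(\mathbb{P},\bar{\mathbb{P}})$ is the set of joint distributions on $\Xi\times\Xi$ with first marginal $\mathbb{P}$ and second marginal $\bar{\mathbb{P}}$, and $\mathrm{D_{KL}}$ is the Kullback–Leibler divergence ($+\infty$ when $\bar{\mathbb{P}}\not\ll\hat{\mathbb{P}}$). Suprema and maxima over $\mathbb{P}$ range over $\mathbb{P}$ for which $\mathbb{E}_{\xi\sim\mathbb{P}}[L(\theta,\xi)]$ is well defined, the penalized objective being $-\infty$ when $\mathrm{UW}(\mathbb{P}\|\hat{\mathbb{P}}_\lambda)=+\infty$. *)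

(* Defs.v *)
From HB Require Import structures.
From mathcomp Require Import all_boot all_order all_algebra.
From mathcomp Require Import all_classical all_reals all_analysis.
From mathcomp Require Import measurable_realfun.

Set Implicit Arguments.
Unset Strict Implicit.
Unset Printing Implicit Defensive.

Import Order.TTheory GRing.Theory Num.Theory.
Import numFieldNormedType.Exports.

Local Open Scope classical_set_scope.
Local Open Scope ring_scope.
Local Open Scope ereal_scope.
Local Open Scope charge_scope.

(* A finitely supported probability distribution, given by its atoms and
   weights. The atoms need not be distinct. *)
Record empirical d (T : measurableType d) (R : realType) := Empirical {
  emp_idx : finType;
  emp_atom : emp_idx -> T;
  emp_weight : emp_idx -> R;
  emp_weight_ge0 : forall k, (0 <= emp_weight k)%R;
  emp_weight_sum1 : (\sum_k emp_weight k = 1)%R }.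

Definition emp_measure d (T : measurableType d) (R : realType)
    (e : empirical T R) (A : set T) : \bar R :=
  \sum_(k : emp_idx e) (emp_weight k)%:E * \d_(emp_atom k) A.

Section emp_measure_probability.
Context d (T : measurableType d) (R : realType) (e : empirical T R).

Let term (k : emp_idx e) : {measure set T -> \bar R} :=
  mscale (NngNum (emp_weight_ge0 k)) \d_(emp_atom k).

Let emp_measureE A : emp_measure e A = \sum_(k : emp_idx e) term k A.
Proof. by []. Qed.

Let emp0 : emp_measure e set0 = 0.
Proof. by rewrite emp_measureE big1// => k _; rewrite measure0. Qed.

Let emp_ge0 A : 0 <= emp_measure e A.
Proof. by rewrite emp_measureE; apply: sume_ge0. Qed.

Let emp_sigma_additive : semi_sigma_additive (emp_measure e).
Proof.
move=> F mF tF mUF; rewrite [X in _ --> X](_ : _ =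
    lim ((fun n => \sum_(0 <= i < n) emp_measure e (F i)) @ \oo)).
  by apply: is_cvg_ereal_nneg_natsum => k _; exact: emp_ge0.
rewrite emp_measureE; under [in RHS]eq_eseriesr do rewrite emp_measureE.
rewrite nneseries_sum//; apply: eq_bigr => /= k _.
exact: (@measure_semi_bigcup _ _ _ (term k)).
Qed.

HB.instance Definition _ := isMeasure.Build _ _ _ (emp_measure e)
  emp0 emp_ge0 emp_sigma_additive.

Let emp_setT : emp_measure e setT = 1.
Proof.
rewrite /emp_measure; under eq_bigr do rewrite diracT mule1.
by rewrite sumEFin emp_weight_sum1.
Qed.

HB.instance Definition _ := Measure_isProbability.Build _ _ _ (emp_measure e)
  emp_setT.

End emp_measure_probability.

(* Expectation under a finitely supported distribution of a function that need
   not be measurable: the measure has an obvious extension to all subsets. For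
   measurable functions it is the integral (lemma emp_expectationE). It is
   needed because a supremum over an arbitrary space need not be measurable, and
   singletons are not assumed to be measurable. *)
Definition emp_expectation d (T : measurableType d) (R : realType)
    (e : empirical T R) (g : T -> \bar R) : \bar R :=
  \sum_(k : emp_idx e) (emp_weight k)%:E * g (emp_atom k).

Lemma emp_expectationE d (T : measurableType d) (R : realType)
    (e : empirical T R) (g : T -> \bar R) :
  measurable_fun setT g -> (forall x, 0 <= g x) ->
  emp_expectation e g = \int[emp_measure e]_x g x.
Proof.
move=> mg g0.
pose term (k : emp_idx e) : {measure set T -> \bar R} :=
  mscale (NngNum (emp_weight_ge0 k)) \d_(emp_atom k).
pose m (n : nat) : {measure set T -> \bar R} :=
  if insub n is Some i then term (@enum_val _ predT i) else mzero.
have mE (i : 'I_#|emp_idx e|) : m i = term (enum_val i) by rewrite /m valK.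
have bigE (F : emp_idx e -> \bar R) :
    \sum_k F k = \sum_(i < #|emp_idx e|) F (@enum_val _ predT i).
  by rewrite -(@big_enum_val _ _ _ _ predT F).
rewrite (@eq_measure_integral _ _ _ setT (msum m #|emp_idx e|)); last first.
  move=> A mA _; rewrite /msum; etransitivity; first exact: bigE.
  by apply: eq_bigr => i _; rewrite mE.
rewrite ge0_integral_measure_sum// /emp_expectation bigE.
apply: eq_bigr => i _; rewrite mE ge0_integral_mscale//=.
by rewrite integral_dirac// diracT mul1e.
Qed.

(* The mixture \sum_i lam_i e_i, indexed by the pairs (i, k) with k indexing an
   atom of e_i (lemma emp_mixtureE). *)
Section mixture.
Context d (T : measurableType d) (R : realType) (N : nat) (lam : 'I_N -> R).
Hypothesis lam_ge0 : forall i, (0 <= lam i)%R.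
Hypothesis lam_sum1 : (\sum_i lam i = 1)%R.
Variable e : 'I_N -> empirical T R.

Let idx : finType := {i : 'I_N & emp_idx (e i)}.
Let atom (p : idx) : T := emp_atom (tagged p).
Let weight (p : idx) : R := (lam (tag p) * emp_weight (tagged p))%R.

Let weight_ge0 p : (0 <= weight p)%R.
Proof. by rewrite mulr_ge0// emp_weight_ge0. Qed.

Let weight_sum1 : (\sum_p weight p = 1)%R.
Proof.
transitivity (\sum_(i < N) \sum_(k : emp_idx (e i)) lam i * emp_weight k)%R.
  by rewrite sig_big_dep.
rewrite -lam_sum1; by apply: eq_bigr => i _; rewrite -mulr_sumr emp_weight_sum1 mulr1.
Qed.

Definition emp_mixture : empirical T R := Empirical atom weight_ge0 weight_sum1.

Lemma emp_mixtureE A :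
  emp_measure emp_mixture A = \sum_(i < N) (lam i)%:E * emp_measure (e i) A.
Proof.
transitivity (\sum_(i < N) \sum_(k : emp_idx (e i))
    (lam i * emp_weight k)%:E * \d_(emp_atom k) A).
  by rewrite sig_big_dep.
apply: eq_bigr => i _; rewrite /emp_measure ge0_sume_distrr => [|k _]; last first.
  by rewrite mule_ge0// lee_fin emp_weight_ge0.
by apply: eq_bigr => k _; rewrite EFinM muleA.
Qed.

End mixture.

Section unbalanced_wasserstein.
Context d (Xi : measurableType d) (R : realType).
Implicit Types (P Q : probability Xi R) (c : Xi * Xi -> R) (X : Xi -> R).

(* The negative part of the integrand is P-integrable, so the integral is the
   usual value in [0, +oo]. *)
Definition KL P Q : \bar R :=
  if `[< P `<< Q >] then
    \int[P]_x lne (('d (charge_of_finite_measure P) '/d Q) x)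
  else +oo.

Definition coupling P Q (g : probability (Xi * Xi)%type R) : Prop :=
  (forall A, measurable A -> g (A `*` setT) = P A) /\
  (forall B, measurable B -> g (setT `*` B) = Q B).

Definition UW c (beta : R) P Q : \bar R :=
  ereal_inf [set u | exists Pbar g,
    coupling P Pbar g /\ u = 'E_g[c] + beta%:E * KL Pbar Q].

(* The expectation of X exists in [-oo, +oo]. *)
Definition expectation_defined P X : Prop :=
  \int[P]_x (EFin \o X)^\+ x +? - (\int[P]_x (EFin \o X)^\- x).

Definition penalized_objective X (rho : R) c (beta : R) Q P : \bar R :=
  if UW c beta P Q == +oo then -oo else 'E_P[X] - rho%:E * UW c beta P Q.

Definition penalized_maximizer X (rho : R) c (beta : R) Q P : Prop :=
  expectation_defined P X /\
  forall P', expectation_defined P' X ->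
    penalized_objective X rho c beta Q P' <= penalized_objective X rho c beta Q P.

Definition penalized_sup X (rho : R) c (zeta : Xi) : \bar R :=
  ereal_sup [set (X xi - rho * c (xi, zeta))%:E | xi in [set: Xi]].

End unbalanced_wasserstein.

(* Main.v *)
(* The result is the duality
     max_P { E_P[X] - rho UW(P, Q) } = rho beta ln E_Q[e^(f / (rho beta))]
   evaluated at its maximizer, where Q has atoms a_k of weights w_k.
   For <=, a second marginal dominated by Q is carried by the atoms, so
   X(xi) - rho c(xi, zeta) <= f(zeta) holds almost surely under the coupling,
   and the Gibbs variational inequality over the atoms concludes.
   For >=, pick any points xi_k and test with the law of xi_k when k has the
   Gibbs weights v_k ~ w_k exp((X(xi_k) - rho c(xi_k, a_k)) / (rho beta)),
   coupled to the law of a_k; then take the supremum over the xi_k.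
   Since the sigma-algebra may fail to separate the atoms (or any points), f
   need not be measurable and divergences are not sums over the atoms. The first
   point is handled by a measurable retraction onto the atoms, the second by the
   log-sum inequality. *)
Require Import Defs.
From mathcomp Require Import all_boot all_order all_algebra.
From mathcomp Require Import all_classical all_reals all_analysis.
From mathcomp Require Import measurable_realfun.
From mathcomp Require Import ring lra.

Import Order.TTheory GRing.Theory Num.Theory.
Import numFieldNormedType.Exports.

Local Open Scope classical_set_scope.
Local Open Scope ring_scope.
Local Open Scope ereal_scope.

(** * Points that measurable sets do not separate *)

(** Each point of [s] separable from [x] is removed by intersecting with a separating set or its
    complement; finitely many intersections suffice. *)
Lemma measurable_separation {d} {T : measurableType d} (x : T) (s : seq T) :
  exists2 B : set T, measurable B /\ B x &
    forall y, y \in s -> B y -> forall C, measurable C -> C x <-> C y.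
Proof.
elim: s => [|z s [B [mB Bx] IH]]; first by exists setT.
have [xz|] := pselect (forall C, measurable C -> C x <-> C z).
  by exists B => // y; rewrite inE => /predU1P[-> _|ys]; [exact: xz|exact: IH].
move=> /existsNP[C /not_implyP[mC nC]].
have [D [mD Dx] nDz] : exists2 D : set T, measurable D /\ D x & ~ D z.
  have [Cx|nCx] := pselect (C x); first by exists C => // Cz; apply: nC.
  exists (~` C); first by split => //; exact: measurableC.
  by apply; apply: contrapT => nCz; apply: nC.
exists (B `&` D); first by split => //; exact: measurableI.
by move=> y; rewrite inE => /predU1P[-> []//|ys [By _]]; exact: IH.
Qed.

(* The atoms need not be measurable singletons, hence [tau] only retracts onto
   them up to points that no measurable set separates. *)
Lemma measurable_retraction {d} {T : measurableType d} (x0 : T) (s : seq T) :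
  exists tau : T -> T,
    [/\ forall D, measurable (tau @^-1` D), forall z, tau z \in x0 :: s &
        forall x, x \in s -> forall B, measurable B -> B x <-> B (tau x)].
Proof.
elim: s => [|x s [tau [mtau itau stau]]].
  exists (cst x0); split=> [D|z|//]; last by rewrite mem_head.
  by rewrite preimage_cst; case: ifP.
have [B [mB Bx] sB] := measurable_separation x s.
(* An earlier atom that falls into [B] is inseparable from [x], so sending it to [x] does no
   harm. *)
exists (fun z => if z \in B then x else tau z); split => [D|z|y].
- have -> : (fun z => if z \in B then x else tau z) @^-1` D =
      (B `&` cst x @^-1` D) `|` (~` B `&` tau @^-1` D).
    apply/seteqP; split=> z /=.
      by case: ifPn; [rewrite inE; left|rewrite notin_setE; right].
    by move=> [[Bz Dx]|[nBz Dz]]; [rewrite mem_set|rewrite memNset].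
  apply: measurableU; apply: measurableI => //; last exact: measurableC.
  by rewrite preimage_cst; case: ifP.
- case: ifP => _; first by rewrite !inE eqxx orbT.
  by have := itau z; rewrite !inE => /predU1P[->|->]; rewrite ?eqxx ?orbT.
- rewrite inE => /predU1P[->|ys] C mC; first by rewrite mem_set.
  by case: ifPn => [/set_mem By|_]; [rewrite (sB y)|exact: stau].
Qed.

(** * Entropy inequalities for finite sums *)

Section log_sum.
Context {R : realType}.

(** Termwise this is [ln t <= t - 1] at [t = q i / p i]; a vanishing [p i] leaves only
    [0 <= q i]. *)
Lemma log_sum_ineq (I : finType) (p q : I -> R) :
  (forall i, 0 <= p i)%R -> (forall i, 0 <= q i)%R ->
  (forall i, 0 < p i -> 0 < q i)%R ->
  (\sum_i p i * (ln (q i) - ln (p i)) <= \sum_i q i - \sum_i p i)%R.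
Proof.
move=> p0 q0 pq; rewrite -sumrB; apply: ler_sum => i _.
have := p0 i; rewrite le_eqVlt => /predU1P[<-|pi0].
  by rewrite mul0r subr0.
have qi0 := pq i pi0.
rewrite -ln_div ?posrE//.
apply: (@le_trans _ _ (p i * (q i / p i - 1))%R).
  apply: ler_wpM2l; first exact: ltW.
  rewrite -[X in ln X](subrKC 1%R); apply: le_ln1Dx.
  by rewrite ltrBrDl addrN divr_gt0.
by rewrite mulrBr mulr1 mulrCA mulfV ?mulr1// gt_eqF.
Qed.

(** The log-sum inequality for [w h] against the Gibbs law proportional to [w exp psi], both of mass
    one. *)
Lemma gibbs_variational (I : finType) (w h psi : I -> R) :
  (forall i, 0 <= w i)%R -> (forall i, 0 <= w i * h i)%R ->
  (\sum_i w i * h i = 1)%R ->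
  (\sum_i w i * h i * psi i <=
    \sum_i w i * h i * ln (h i) + ln (\sum_i w i * expR (psi i)))%R.
Proof.
move=> w0 wh0 wh1; set Z := (\sum_i w i * expR (psi i))%R.
have Z_ge0 : (0 <= Z)%R.
  by apply: sumr_ge0 => i _; rewrite mulr_ge0// expR_ge0.
have whgt i : (0 < w i * h i)%R -> (0 < w i)%R /\ (0 < h i)%R.
  have := w0 i; rewrite le_eqVlt => /predU1P[<-|wi0].
    by rewrite mul0r ltxx.
  by rewrite pmulr_rgt0.
have Z0 : (0 < Z)%R.
  rewrite lt_neqAle Z_ge0 andbT; apply/eqP => /esym Z0.
  have w_eq0 i : w i = 0%R.
    have /eqP := psumr_eq0P
      (fun i _ => mulr_ge0 (w0 i) (expR_ge0 (psi i))) Z0 (erefl : xpredT i).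
    by rewrite mulf_eq0 (gt_eqF (expR_gt0 _)) orbF => /eqP.
  move: wh1; rewrite big1 => [/eqP|i _]; first by rewrite eq_sym oner_eq0.
  by rewrite w_eq0 mul0r.
have := @log_sum_ineq _ (fun i => w i * h i)%R (fun i => w i * expR (psi i) / Z)%R wh0.
rewrite wh1 -mulr_suml -/Z divff ?gt_eqF// subrr => H.
rewrite -subr_le0 opprD addrA -sumrB -(mul1r (ln Z)) -wh1 mulr_suml -sumrB.
apply: le_trans (H _ _); last 2 first.
- by move=> i; rewrite divr_ge0// mulr_ge0// expR_ge0.
- by move=> i /whgt[wi0 _]; rewrite divr_gt0// mulr_gt0// expR_gt0.
rewrite le_eqVlt; apply/orP; left; apply/eqP; apply: eq_bigr => i _.
have := wh0 i; rewrite le_eqVlt => /predU1P[<-|/whgt[wi0 hi0]].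
  by rewrite !mul0r !subr0.
rewrite ln_div ?posrE ?mulr_gt0 ?expR_gt0// !lnM ?posrE ?expR_gt0// expRK.
ring.
Qed.

End log_sum.

(** * Integrals and divergences for finitely supported laws *)

Section empirical_integral.
Context {d} {T : measurableType d} {R : realType}.
Implicit Types (e : empirical T R) (P Q : probability T R).

(** Atoms without mass are harmless even where [g] is infinite, because zero times an infinite value
    is [0]. *)
Lemma emp_expectation_fin e (g : T -> \bar R) (r : emp_idx e -> R) :
  (forall k, 0 < emp_weight k -> g (emp_atom k) = (r k)%:E)%R ->
  emp_expectation e g = (\sum_k emp_weight k * r k)%:E.
Proof.
move=> gr; rewrite -sumEFin; apply: eq_bigr => k _.
have := emp_weight_ge0 k; rewrite le_eqVlt => /predU1P[<-|/gr ->//].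
by rewrite mul0e mul0r.
Qed.

Lemma integral_emp e (g : T -> \bar R) (r : emp_idx e -> R) :
  measurable_fun setT g ->
  (forall k, 0 < emp_weight k -> g (emp_atom k) = (r k)%:E)%R ->
  \int[emp_measure e]_x g x = (\sum_k emp_weight k * r k)%:E.
Proof.
move=> mg gr; rewrite integralE -!emp_expectationE//; last 2 first.
- exact: measurable_funeneg.
- exact: measurable_funepos.
rewrite (@emp_expectation_fin e g^\+ (fun k => Num.max (r k) 0)%R); last first.
  by move=> k /gr gk; rewrite funeposE gk EFin_max.
rewrite (@emp_expectation_fin e g^\- (fun k => Num.max (- r k) 0)%R); last first.
  by move=> k /gr gk; rewrite funenegE gk EFin_max.
rewrite -EFinB -sumrB; congr EFin; apply: eq_bigr => k _ /=.
rewrite -mulrBr; congr (_ * _)%R; have [r0|/ltW r0] := leP 0%R (r k).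
  by rewrite max_r ?oppr_le0// subr0.
by rewrite max_l ?oppr_ge0// sub0r opprK.
Qed.

Lemma expectation_emp e (X : T -> R) : measurable_fun setT X ->
  'E_(emp_measure e)[X] = (\sum_(k : emp_idx e) emp_weight k * X (emp_atom k))%:E.
Proof.
by move=> mX; rewrite unlock (@integral_emp e _ (fun k => X (emp_atom k)))//;
  exact/measurable_EFinP.
Qed.

Lemma emp_measure_indic e (A : set T) :
  emp_measure e A = (\sum_(k : emp_idx e) emp_weight k * \1_A (emp_atom k))%:E.
Proof.
rewrite -sumEFin; apply: eq_bigr => k _.
by rewrite EFinM diracE indicE.
Qed.

Lemma emp_weight_exists_gt0 e : exists k : emp_idx e, (0 < emp_weight k)%R.
Proof.
apply: contrapT => /forallNP n0; have /eqP := emp_weight_sum1 e.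
rewrite big1 => [|k _]; first by rewrite eq_sym oner_eq0.
by apply/eqP; rewrite eq_le emp_weight_ge0 andbT leNgt; apply/negP/n0.
Qed.

Lemma emp_measure_gt0 e (A : set T) (k : emp_idx e) :
  (0 < emp_weight k)%R -> A (emp_atom k) -> 0 < emp_measure e A.
Proof.
move=> wk Ak; rewrite emp_measure_indic lte_fin (bigD1 k)//= indicE mem_set//.
rewrite mulr1 ltr_pwDl// sumr_ge0// => j _.
by rewrite mulr_ge0 ?emp_weight_ge0// indicE.
Qed.

(* On the atoms of [e] carrying mass, [h] is the density of [P]. *)
Lemma KL_emp e P : P `<< emp_measure e ->
  exists (h : T -> R)
    (wh0 : forall k : emp_idx e, (0 <= emp_weight k * h (emp_atom k))%R)
    (wh1 : (\sum_(k : emp_idx e) emp_weight k * h (emp_atom k) = 1)%R),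
    (forall A, measurable A ->
      P A = emp_measure (Empirical (@emp_atom _ _ _ e) wh0 wh1) A) /\
    forall e', (forall A, measurable A -> P A = emp_measure e' A) ->
      (forall k : emp_idx e', 0 < emp_weight k -> 0 < h (emp_atom k))%R /\
      KL P (emp_measure e) =
        (\sum_(k : emp_idx e') emp_weight k * ln (h (emp_atom k)))%:E.
Proof.
move=> Pe; pose Q : probability T R := emp_measure e.
pose D := Radon_Nikodym (charge_of_finite_measure P) Q.
have PQ : charge_of_finite_measure P `<< Q := Pe.
have mD : measurable_fun setT D.
  by apply: measurable_int; exact: (Radon_Nikodym_integrable PQ).
have finD x : D x \is a fin_num by exact: Radon_Nikodym_fin_num.
pose h x := fine (D x).
have DE x : D x = (h x)%:E by rewrite fineK.
have PE A : measurable A ->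
    P A = (\sum_(k : emp_idx e) emp_weight k * (h (emp_atom k) * \1_A (emp_atom k)))%:E.
  move=> mA; have -> : P A = \int[emp_measure e]_(x in A) D x.
    exact: (Radon_Nikodym_integral PQ).
  rewrite integral_mkcond; apply: integral_emp.
    by apply/(measurable_restrictT _ mA); exact: measurable_funTS.
  by move=> k _; rewrite patchE indicE DE; case: ifP; rewrite ?mulr1 ?mulr0.
have mh : measurable_fun setT h by exact: measurableT_comp.
(* The sign of the derivative is known only through [P]: an atom with mass and negative [h] would
   make [P S] negative. *)
have wh0 (k : emp_idx e) : (0 <= emp_weight k * h (emp_atom k))%R.
  pose S := h @^-1` [set y | (y < 0)%R].
  have mS : measurable S.
    by rewrite -[S]setTI; apply: mh => //; rewrite -set_itvNyo; exact: measurable_itv.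
  have : 0 <= P S by [].
  rewrite PE// lee_fin => S0.
  rewrite leNgt; apply/negP => whk; move: S0; apply/negP; rewrite -ltNge.
  have hk : (h (emp_atom k) < 0)%R.
    rewrite ltNge; apply/negP => hk; move: whk.
    by rewrite ltNge mulr_ge0// emp_weight_ge0.
  rewrite (bigD1 k)//= indicE mem_set// mulr1 ltr_nwDl// sumr_le0// => j _.
  rewrite indicE; have [/set_mem/ltW Sj|_] := boolP (_ \in _).
    by rewrite mulr1 mulr_ge0_le0// emp_weight_ge0.
  by rewrite !mulr0.
have wh1 : (\sum_(k : emp_idx e) emp_weight k * h (emp_atom k) = 1)%R.
  apply: EFin_inj; rewrite -[RHS](@probability_setT _ _ _ P) PE//; congr EFin.
  by apply: eq_bigr => k _; rewrite indicT mulr1.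
exists h, wh0, wh1; split.
  move=> A mA; rewrite PE// emp_measure_indic; congr EFin.
  by apply: eq_bigr => k _; rewrite mulrA.
(* [e'] is any finite presentation of [P]; it may spread mass over inseparable atoms differently
   from the weights [emp_weight k * h (emp_atom k)]. *)
move=> e' Pe'.
have h_gt0 (k : emp_idx e') : (0 < emp_weight k -> 0 < h (emp_atom k))%R.
  move=> wk; rewrite ltNge; apply/negP => hk.
  pose S := h @^-1` [set y | (y <= 0)%R].
  have mS : measurable S.
    by rewrite -[S]setTI; apply: mh => //; rewrite -set_itvNyc; exact: measurable_itv.
  have : 0 < P S by rewrite Pe'//; exact: (@emp_measure_gt0 _ _ k).
  rewrite PE// lte_fin ltNge => /negP; apply.
  apply: sumr_le0 => j _; rewrite indicE.
  have [/set_mem Sj|_] := boolP (_ \in _).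
    by rewrite mulr1 mulr_ge0_le0// emp_weight_ge0.
  by rewrite !mulr0.
split=> //; rewrite /KL asboolT//.
rewrite (@eq_measure_integral _ _ _ setT (emp_measure e')); last by move=> A mA _; exact: Pe'.
apply: integral_emp.
  rewrite [X in measurable_fun _ X](_ : _ = fun x =>
      if (h x <= 0)%R then -oo else (ln (h x))%:E); last first.
    by apply/funext => x; rewrite -/(D x) DE.
  apply: measurable_fun_ifT => //.
    exact: measurable_fun_ler.
  by apply/measurable_EFinP; exact: measurableT_comp.
by move=> k /h_gt0 hk; rewrite -/(D _) DE lne_EFin.
Qed.

Lemma KL_emp_ge0 e P : 0 <= KL P (emp_measure e).
Proof.
have [Pe|nPe] := pselect (P `<< emp_measure e); last by rewrite /KL asboolF.
have [h [wh0 [wh1 [PE /(_ _ PE)[_ ->]]]]] := KL_emp _ _ Pe.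
rewrite lee_fin.
have := gibbs_variational _ _ _ (fun=> 0%R) (fun k => emp_weight_ge0 k) wh0 wh1.
under eq_bigr do rewrite mulr0.
under [X in ln X]eq_bigr do rewrite expR0 mulr1.
by rewrite big1// emp_weight_sum1 ln1 addr0.
Qed.

(* A finer partition can only increase the divergence; here the partition into
   atom indices is finer than what the sigma-algebra sees. *)
Lemma KL_reweight_le e (v : emp_idx e -> R) (v0 : forall k, (0 <= v k)%R)
    (v1 : (\sum_k v k = 1)%R) :
  (forall k, 0 < v k -> 0 < emp_weight k)%R ->
  KL (emp_measure (Empirical (@emp_atom _ _ _ e) v0 v1)) (emp_measure e) <=
  (\sum_k v k * (ln (v k) - ln (emp_weight k)))%:E.
Proof.
move=> vw; set e' := Empirical _ _ _.
have Pe : emp_measure e' `<< emp_measure e.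
  apply/null_content_dominatesP => A mA QA0; change (emp_measure e' A = 0).
  have {QA0} : emp_measure e A = 0 := QA0.
  have A0 k : (0 <= \1_A (@emp_atom _ _ _ e k) :> R)%R by rewrite indicE.
  rewrite !emp_measure_indic => H; have {}H := EFin_inj H.
  move: H => /(psumr_eq0P (fun k _ => mulr_ge0 (emp_weight_ge0 k) (A0 k))) wA.
  congr EFin; apply: big1 => k _ /=.
  have := v0 k; rewrite le_eqVlt => /predU1P[<-|/vw wk]; first by rewrite mul0r.
  have /eqP := wA k erefl.
  by rewrite mulf_eq0 gt_eqF//= => /eqP ->; rewrite mulr0.
have [h [wh0 [wh1 [PE hP]]]] := KL_emp _ _ Pe.
have [hgt ->] := hP _ (fun A _ => erefl).
rewrite lee_fin -subr_le0 -sumrB.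
have vwh k : (0 < v k -> 0 < emp_weight k * h (emp_atom k))%R.
  by move=> vk; rewrite mulr_gt0 ?vw// hgt.
(* The density [h] need not be [v / w] at each index, but the difference of the two sides is a
   log-sum of [v] against [w h], both of mass one. *)
have := log_sum_ineq _ v (fun k => emp_weight k * h (emp_atom k))%R v0 wh0 vwh.
rewrite wh1 v1 subrr; apply: le_trans.
rewrite le_eqVlt; apply/orP; left; apply/eqP; apply: eq_bigr => k _ /=.
have := v0 k; rewrite le_eqVlt => /predU1P[<-|vk]; first by rewrite !mul0r subrr.
by rewrite lnM ?posrE ?vw ?hgt//; ring.
Qed.
End empirical_integral.

(** * Change of variables and almost sure comparison *)

Section integral_comparison.
Context {R : realType}.

(** Positive and negative parts are transported separately, which covers nonintegrable [f]. *)
Lemma integral_image {d1 d2} {T1 : measurableType d1} {T2 : measurableType d2}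
    (mu : {measure set T1 -> \bar R}) (nu : {measure set T2 -> \bar R})
    (phi : T1 -> T2) (f : T2 -> \bar R) :
  measurable_fun setT phi -> measurable_fun setT f ->
  (forall A, measurable A -> nu A = mu (phi @^-1` A)) ->
  \int[nu]_y f y = \int[mu]_x f (phi x).
Proof.
move=> mphi mf numu.
have ge0E (h : T2 -> \bar R) : measurable_fun setT h -> (forall y, 0 <= h y) ->
    \int[nu]_y h y = \int[mu]_x h (phi x).
  move=> mh h0; rewrite -[RHS](ge0_integral_pushforward mphi mu measurableT mh)//.
  by apply: eq_measure_integral => A mA _; exact: numu.
rewrite integralE [RHS]integralE; congr (_ - _).
  rewrite ge0E//; last exact: measurable_funepos.
  by apply: eq_integral => x _; rewrite !funeposE.
rewrite ge0E//; last exact: measurable_funeneg.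
by apply: eq_integral => x _; rewrite !funenegE.
Qed.

(* No integrability is assumed: a non-integrable negative part of [X] sends the
   left-hand side to [-oo]. *)
Lemma le_integral_null {d} {T : measurableType d}
    (mu : {measure set T -> \bar R}) (X G : T -> R) :
  measurable_fun setT X -> measurable_fun setT G ->
  mu [set x | (G x < X x)%R] = 0 ->
  \int[mu]_x (X x)%:E <= \int[mu]_x (G x)%:E.
Proof.
move=> mX mG GX0.
have mX' : measurable_fun setT (EFin \o X) by exact/measurable_EFinP.
have mG' : measurable_fun setT (EFin \o G) by exact/measurable_EFinP.
have aeXG : {ae mu, forall x, (X x <= G x)%R}.
  exists [set x | (G x < X x)%R]; split => //.
    have := measurable_fun_ltr mG mX measurableT (measurableI [set true] setT _ _).
    by rewrite setIT setTI; apply.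
  by move=> x /= /negP; rewrite -ltNge.
rewrite integralE [leRHS]integralE; apply: leeB; apply: ae_ge0_le_integral => //.
- exact: measurable_funepos.
- exact: measurable_funepos.
- apply: filterS aeXG => x XG _; rewrite !funeposE.
  by rewrite -!EFin_max lee_fin ge_max !le_max XG lexx orbT.
- exact: measurable_funeneg.
- exact: measurable_funeneg.
- apply: filterS aeXG => x XG _; rewrite !funenegE.
  by rewrite -!EFinN -!EFin_max lee_fin ge_max !le_max lerN2 XG lexx orbT.
Qed.

End integral_comparison.

(** * Couplings with a finitely supported marginal *)

Section couplings.
Context {d} {Xi : measurableType d} {R : realType}.
Implicit Types (P Q : probability Xi R) (c : Xi * Xi -> R) (X : Xi -> R).

(** A measurable [B] and its preimage under [tau] contain the same atoms with mass, so they differ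
    by a null set of the second marginal. Hence the two measures agree on rectangles, a pi-system
    generating the product sigma-algebra. *)
Lemma coupling_retraction (e : empirical Xi R) P
    (g : probability (Xi * Xi)%type R) (tau : Xi -> Xi) :
  coupling P (emp_measure e) g -> measurable_fun setT tau ->
  (forall k : emp_idx e, (0 < emp_weight k)%R -> forall B, measurable B ->
    B (emp_atom k) <-> B (tau (emp_atom k))) ->
  forall S, measurable S -> g ((fun p => (p.1, tau p.2)) @^-1` S) = g S.
Proof.
move=> [_ gQ] mtau tauE S mS; pose Q : probability Xi R := emp_measure e.
pose phi (p : Xi * Xi) := (p.1, tau p.2).
have mphi : measurable_fun setT phi.
  by apply: measurable_fun_pair => //; exact: measurableT_comp.
have Q0 B : measurable B -> (forall k : emp_idx e, (0 < emp_weight k)%R -> ~ B (emp_atom k)) ->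
    Q B = 0.
  move=> mB nB; change (emp_measure e B = 0); rewrite emp_measure_indic big1// => k _.
  have := emp_weight_ge0 k; rewrite le_eqVlt => /predU1P[<-|wk].
    by rewrite mul0r.
  by rewrite indicE memNset ?mulr0//; exact: nB.
have mtauB B : measurable B -> measurable (tau @^-1` B).
  by move=> mB; rewrite -[X in measurable X]setTI; exact: mtau.
have g0 (A B : set Xi) : measurable A -> measurable B -> Q B = 0 -> g (A `*` B) = 0.
  move=> mA mB QB0; apply: (@subset_measure0 _ _ _ _ _ (setT `*` B)).
  - exact: measurableX.
  - exact: measurableX.
  - by move=> p [].
  - exact: etrans (gQ B mB) QB0.
have gD (A B : set Xi) : measurable A -> measurable B ->
    g (A `*` tau @^-1` B) = g (A `*` B).
  move=> mA mB; pose C := tau @^-1` B.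
  have splitX (E F : set Xi) : measurable E -> measurable F ->
      Q (E `\` F) = 0 -> g (A `*` E) = g (A `*` (E `&` F)).
    move=> mE mF QEF.
    have -> : A `*` E = A `*` (E `&` F) `|` A `*` (E `\` F).
      apply/seteqP; split=> -[x y] /=.
        by move=> [Ax Ey]; have [Fy|nFy] := pselect (F y); [left|right].
      by case=> -[Ax []].
    have mEI : measurable (E `&` F) by exact: measurableI.
    have mED : measurable (E `\` F) by exact: measurableD.
    have disj : A `*` (E `&` F) `&` A `*` (E `\` F) = set0.
      by apply/seteqP; split => // -[x y] /= [[_ [_ Fy]] [_ [_ nFy]]].
    transitivity (g (A `*` (E `&` F)) + g (A `*` (E `\` F))).
      by apply: measureU => //; exact: measurableX.
    by rewrite (g0 _ _ mA mED QEF) adde0.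
  have mC : measurable C by exact: mtauB.
  (* Both rectangles are cut down to the one over the intersection of [B] and [C]. *)
  rewrite (splitX C B)// ?(splitX B C)// 1?setIC//.
  - apply: Q0 => [|k wk [Bk nCk]]; first exact: measurableD.
    by apply: nCk; apply/(tauE k wk B mB).
  - apply: Q0 => [|k wk [Ck nBk]]; first exact: measurableD.
    by apply: nBk; apply/(tauE k wk B mB).
pose G := [set A `*` B | A in @measurable _ Xi & B in @measurable _ Xi].
change (pushforward g phi S = g S).
apply: (measure_unique G (fun=> setT)) => //.
- exact: measurable_prod_measurableType.
- move=> _ _ [A1 mA1 [B1 mB1 <-]] [A2 mA2 [B2 mB2 <-]].
  rewrite -setXI; exists (A1 `&` A2); first exact: measurableI.
  by exists (B1 `&` B2) => //; exact: measurableI.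
- by move=> _; exists setT => //; exists setT => //; rewrite setXTT.
- by rewrite bigcup_const.
- by move=> _ [A mA [B mB <-]]; exact: gD.
- by move=> _; rewrite /= /pushforward preimage_setT probability_setT ltry.
Qed.

End couplings.

(** * Weak and strong duality for the penalized problem *)

Section duality.
Context {d} {Xi : measurableType d} {R : realType}.
Implicit Types (P Q : probability Xi R) (e : empirical Xi R).
Variables (X : Xi -> R) (c : Xi * Xi -> R) (rho beta : R).
Hypotheses (mX : measurable_fun setT X) (mc : measurable_fun setT c).
Hypothesis c_ge0 : forall p, (0 <= c p)%R.
Hypotheses (rho_gt0 : (0 < rho)%R) (beta_gt0 : (0 < beta)%R).

Definition partition_function e : \bar R := emp_expectation e (fun zeta =>
  expeR (penalized_sup X rho c zeta * ((rho * beta)^-1)%:E)).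

Lemma penalized_sup_ge xi zeta :
  (X xi - rho * c (xi, zeta))%:E <= penalized_sup X rho c zeta.
Proof. by apply: ereal_sup_ubound; exists xi. Qed.

Lemma penalized_sup_gtNy zeta : -oo < penalized_sup X rho c zeta.
Proof. exact: lt_le_trans (ltNyr _) (penalized_sup_ge zeta zeta). Qed.

(** Each fibre of [c (xi, _)] is measurable, so inseparable points have equal costs from every [xi].
    This makes the supremum compatible with the retraction. *)
Lemma penalized_sup_inseparable x y :
  (forall B, measurable B -> B x <-> B y) ->
  penalized_sup X rho c x = penalized_sup X rho c y.
Proof.
move=> xy; congr ereal_sup; apply: eq_imagel => xi _; congr (_ - _ * _)%:E.
pose B := (fun z => c (xi, z)) @^-1` [set c (xi, x)].
have mB : measurable B.
  rewrite -[B]setTI; apply: measurable_fun_pair2 => //; exact: measurable_set1.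
by have [/(_ erefl) /= <-] := xy B mB.
Qed.

Lemma partition_function_fin e (phi : emp_idx e -> R) :
  (forall k, (0 < emp_weight k)%R ->
    penalized_sup X rho c (emp_atom k) = (phi k)%:E) ->
  partition_function e =
    (\sum_(k : emp_idx e) emp_weight k * expR (phi k * (rho * beta)^-1))%:E.
Proof. by move=> fE; apply: emp_expectation_fin => k /fE ->. Qed.

Lemma partition_function_pinfty e (k : emp_idx e) : (0 < emp_weight k)%R ->
  penalized_sup X rho c (emp_atom k) = +oo -> partition_function e = +oo.
Proof.
move=> wk fk; rewrite /partition_function /emp_expectation (bigD1 k)//= fk.
rewrite gt0_mulye ?lte_fin ?invr_gt0 ?mulr_gt0// gt0_muley ?lte_fin//.
rewrite addye// gt_eqF// (lt_le_trans (ltNyr 0%R))// sume_ge0// => j _.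
by rewrite mule_ge0 ?lee_fin ?emp_weight_ge0 ?expeR_ge0.
Qed.

Lemma expectation_cost_ge0 (g : probability (Xi * Xi)%type R) : 0 <= 'E_g[c].
Proof. by apply: expectation_ge0. Qed.

Lemma UW_ge0 e P : 0 <= UW c beta P (emp_measure e).
Proof.
apply: le_ereal_inf_tmp => _ [Pbar [g [_ ->]]].
rewrite adde_ge0 ?expectation_cost_ge0// mule_ge0 ?KL_emp_ge0// lee_fin; exact: ltW.
Qed.

(** Integrates [X xi <= rho * c (xi, zeta) + f zeta] against [g], with [f] replaced by its
    composition [F] with a retraction onto the atoms with mass, which is real-valued and
    measurable. *)
Lemma coupling_duality e P (g : probability (Xi * Xi)%type R)
    (phi : emp_idx e -> R) :
  coupling P (emp_measure e) g -> 'E_g[c] < +oo ->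
  (forall k, (0 < emp_weight k)%R ->
    penalized_sup X rho c (emp_atom k) = (phi k)%:E) ->
  'E_P[X] <= rho%:E * 'E_g[c] + (\sum_(k : emp_idx e) emp_weight k * phi k)%:E.
Proof.
move=> gPe Egc fE; have [gP ge] := gPe.
have [k0 wk0] := emp_weight_exists_gt0 e.
(* Only atoms with mass are kept, default point included, so that [tau] avoids those where the
   supremum may be [+oo]. *)
pose s := [seq @emp_atom _ _ _ e k |
  k <- enum [pred k : emp_idx e | (0 < emp_weight k)%R]].
have sP z : z \in s -> exists2 k : emp_idx e, (0 < emp_weight k)%R & z = emp_atom k.
  by move=> /mapP[k]; rewrite mem_enum => wk ->; exists k.
have [tau [mtau taus stau]] := measurable_retraction (@emp_atom _ _ _ e k0) s.
have tauP z : exists2 k : emp_idx e, (0 < emp_weight k)%R & tau z = emp_atom k.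
  by have := taus z; rewrite inE => /predU1P[->|/sP//]; exists k0.
have tau_atom (k : emp_idx e) : (0 < emp_weight k)%R ->
    forall B, measurable B -> B (emp_atom k) <-> B (tau (emp_atom k)).
  by move=> wk; apply: stau; apply/mapP; exists k => //; rewrite mem_enum.
pose F z := fine (penalized_sup X rho c (tau z)).
have F_atom (k : emp_idx e) : (0 < emp_weight k)%R -> F (emp_atom k) = phi k.
  by move=> wk; rewrite /F -(penalized_sup_inseparable _ _ (tau_atom k wk)) fE.
(* Preimages of all sets under [tau] are measurable, so [q] can be arbitrary. *)
have tau_meas D (T : measurableType D) (q : Xi -> T) : measurable_fun setT (q \o tau).
  by move=> _ B _; rewrite setTI comp_preimage; exact: mtau.
have mF : measurable_fun setT F.
  exact: (tau_meas _ _ (fun z => fine (penalized_sup X rho c z))).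
pose G p := (rho * c p + F p.2)%R.
have mF2 : measurable_fun setT (fun p : Xi * Xi => F p.2) by exact: measurableT_comp.
have mG : measurable_fun setT G.
  by apply: measurable_funD => //; exact: measurable_funM.
have mX1 : measurable_fun setT (fun p : Xi * Xi => X p.1) by exact: measurableT_comp.
have GX0 : g [set p | (G p < X p.1)%R] = 0.
  have mS : measurable [set p : Xi * Xi | (G p < X p.1)%R].
    have := measurable_fun_ltr mG mX1 measurableT (measurableI [set true] setT _ _).
    by rewrite setIT setTI; apply.
  (* Once the second coordinate is retracted to an atom with mass, the bound holds everywhere: the
     exceptional set has empty preimage. *)
  rewrite -(coupling_retraction _ _ _ _ gPe (tau_meas _ _ id) tau_atom _ mS).
  rewrite (_ : _ @^-1` _ = set0) ?measure0//; apply/seteqP; split => // -[x z] /=.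
  have [k wk tz] := tauP z; rewrite /G /= tz F_atom//.
  apply/negP; rewrite -leNgt -lerBlDl -lee_fin -fE//; exact: penalized_sup_ge.
have EPX : 'E_P[X] <= \int[g]_p (G p)%:E.
  rewrite unlock (integral_image g P fst) => [|//||A mA].
  - exact: le_integral_null.
  - exact/measurable_EFinP.
  - have -> : fst @^-1` A = A `*` [set: Xi] by apply/seteqP; split => -[x z] //= [].
    exact: esym (gP A mA).
apply: (le_trans EPX).
have integral_snd (q : Xi -> R) : measurable_fun setT q ->
    \int[g]_p (q p.2)%:E = (\sum_(k : emp_idx e) emp_weight k * q (emp_atom k))%:E.
  move=> mq; rewrite -expectation_emp// unlock [RHS](integral_image g _ snd) => [//|//||A mA].
    exact/measurable_EFinP.
  have -> : snd @^-1` A = [set: Xi] `*` A by apply/seteqP; split => -[x z] //= [].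
  exact: esym (ge A mA).
(* Finite cost makes [c] integrable, which allows the integral of [G] to be split. *)
have ic : g.-integrable setT (EFin \o c).
  apply/integrableP; split; first exact/measurable_EFinP.
  move: Egc; rewrite unlock; apply: le_lt_trans.
  by rewrite le_eqVlt; apply/orP; left; apply/eqP; apply: eq_integral => p _; rewrite /= ger0_norm.
have iF : g.-integrable setT (fun p => (F p.2)%:E).
  apply/integrableP; split; first exact/measurable_EFinP.
  rewrite (integral_snd (fun z => `|F z|)%R) ?ltry//; exact: measurableT_comp.
rewrite /G; under eq_integral do rewrite EFinD EFinM.
rewrite integralD//; last exact: integrableZl.
rewrite integralZl// unlock leeD2l// integral_snd// lee_fin.
apply: ler_sum => k _; have := emp_weight_ge0 k; rewrite le_eqVlt => /predU1P[<-|wk].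
  by rewrite !mul0r.
by rewrite F_atom.
Qed.

(** The supremum is never [-oo], so at an atom it can fail to be real only by being [+oo]. *)
Lemma partition_function_cases e : partition_function e = +oo \/
  exists phi : emp_idx e -> R, forall k, (0 < emp_weight k)%R ->
    penalized_sup X rho c (emp_atom k) = (phi k)%:E.
Proof.
have [[k [wk fk]]|nex] := pselect (exists k : emp_idx e,
    (0 < emp_weight k)%R /\ penalized_sup X rho c (emp_atom k) = +oo).
  by left; exact: partition_function_pinfty fk.
right; exists (fun k => fine (penalized_sup X rho c (emp_atom k))) => k wk.
rewrite fineK// fin_numElt penalized_sup_gtNy ltey.
by apply/eqP => fk; apply: nex; exists k.
Qed.

Lemma weighted_exp_gt0 e (psi : emp_idx e -> R) :
  (0 < \sum_(k : emp_idx e) emp_weight k * expR (psi k))%R.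
Proof.
have [k wk] := emp_weight_exists_gt0 e.
rewrite (bigD1 k)//= ltr_pwDl ?mulr_gt0 ?expR_gt0// sumr_ge0// => j _.
by rewrite mulr_ge0 ?emp_weight_ge0 ?expR_ge0.
Qed.

Let rb_gt0 : (0 < rho * beta)%R. Proof. exact: mulr_gt0. Qed.

(** For a dominated second marginal, [coupling_duality] leaves the mean of [phi] under the
    reweighted atoms; the Gibbs inequality trades it for the divergence and the log-partition term.
    Infinite divergence or cost is trivial. *)
Lemma weak_duality e P : 'E_P[X] <=
  rho%:E * UW c beta P (emp_measure e) + (rho * beta)%:E * lne (partition_function e).
Proof.
have [Zy|[phi fE]] := partition_function_cases e.
  rewrite Zy /= gt0_muley ?lte_fin// addey ?leey// gt_eqF//.
  by rewrite (lt_le_trans (ltNyr 0%R))// mule_ge0 ?UW_ge0// lee_fin ltW.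
rewrite (partition_function_fin _ _ fE) lne_EFin ?weighted_exp_gt0// -EFinM.
rewrite -leeBlDr// -lee_pdivrMl//; apply: le_ereal_inf_tmp => _ [Q [g [gPQ ->]]].
have [Qe|nQe] := pselect (Q `<< emp_measure e); last first.
  rewrite /KL asboolF// gt0_muley ?lte_fin// addey ?leey// gt_eqF//.
  exact: lt_le_trans (ltNyr 0%R) (expectation_cost_ge0 g).
have [h [wh0 [wh1 [QE /(_ _ QE)[_ KLE]]]]] := KL_emp _ _ Qe.
have [Egy|Egy] := eqVneq 'E_g[c] +oo; first by rewrite Egy KLE -EFinM addye ?leey.
rewrite lee_pdivrMl// leeBlDr//.
(* [e'] presents the second marginal on the atoms of [e]; where it has mass so does [e], so [phi]
   remains valid. *)
set e' := Empirical (@emp_atom _ _ _ e) wh0 wh1 in QE KLE.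
have gPe' : coupling P (emp_measure e') g.
  by case: gPQ => gP gQ; split => // B mB; exact: etrans (gQ B mB) (QE B mB).
have fE' (k : emp_idx e') : (0 < emp_weight k)%R ->
    penalized_sup X rho c (emp_atom k) = (phi k)%:E.
  move=> /= whk; apply: fE; rewrite lt_neqAle emp_weight_ge0 andbT eq_sym.
  by apply: contraTneq whk => ->; rewrite mul0r ltxx.
apply: le_trans (coupling_duality _ _ _ _ gPe' _ fE') _; first by rewrite ltey.
rewrite KLE ge0_muleDr ?expectation_cost_ge0//; last first.
  by rewrite -KLE mule_ge0 ?KL_emp_ge0// lee_fin ltW.
rewrite -addeA leeD2l// -!EFinM -EFinD lee_fin /=.
have := gibbs_variational _ _ _ (fun k => phi k * (rho * beta)^-1)%R
  (fun k => @emp_weight_ge0 _ _ _ e k) wh0 wh1.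
rewrite [X in (X <= _)%R](_ : _ = (\sum_(k : emp_idx e) emp_weight k *
  h (emp_atom k) * phi k) / (rho * beta))%R; last first.
  by rewrite mulr_suml; apply: eq_bigr => k _; rewrite mulrA.
by rewrite ler_pdivrMr// mulrC mulrDr mulrA.
Qed.

(** With the divergence counted over indices, the objective at the Gibbs weights [v] equals the
    left-hand side. The actual [UW] is at most that cost, so the actual objective is at least as
    large. *)
Lemma reweighted_bound e (xi : emp_idx e -> Xi) (M : \bar R) :
  (forall P, expectation_defined P X ->
    penalized_objective X rho c beta (emp_measure e) P <= M) ->
  ((rho * beta) * ln (\sum_(k : emp_idx e) emp_weight k *
    expR ((X (xi k) - rho * c (xi k, emp_atom k)) / (rho * beta))))%:E <= M.
Proof.
pose F k := (X (xi k) - rho * c (xi k, emp_atom k))%R.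
set Z := (\sum_k _)%R => PM.
have Z0 : (0 < Z)%R by exact: weighted_exp_gt0.
pose v k := (emp_weight k * expR (F k / (rho * beta)) / Z)%R.
have v0 (k : emp_idx e) : (0 <= v k)%R.
  by rewrite divr_ge0 ?mulr_ge0 ?emp_weight_ge0 ?expR_ge0// ltW.
have v1 : (\sum_(k : emp_idx e) v k = 1)%R by rewrite -mulr_suml divff ?gt_eqF.
have vw (k : emp_idx e) : (0 < v k -> 0 < emp_weight k)%R.
  move=> vk; rewrite lt_neqAle emp_weight_ge0 andbT eq_sym.
  by apply: contraTneq vk; rewrite /v => ->; rewrite !mul0r ltxx.
pose P : empirical Xi R := Empirical xi v0 v1.
pose Q : empirical Xi R := Empirical (@emp_atom _ _ _ e) v0 v1.
pose g : empirical (Xi * Xi)%type R :=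
  Empirical (fun k : emp_idx e => (xi k, emp_atom k)) v0 v1.
have gPQ : coupling (emp_measure P) (emp_measure Q) (emp_measure g).
  split=> A mA.
    change (emp_measure g (A `*` setT) = emp_measure P A).
    rewrite !emp_measure_indic; congr EFin; apply: eq_bigr => k _.
    by rewrite !indicE in_setX in_setT andbT.
  change (emp_measure g (setT `*` A) = emp_measure Q A).
  rewrite !emp_measure_indic; congr EFin; apply: eq_bigr => k _.
  by rewrite !indicE in_setX in_setT.
have UWle : UW c beta (emp_measure P) (emp_measure e) <=
    (\sum_(k : emp_idx e) v k * c (xi k, emp_atom k) +
     beta * \sum_(k : emp_idx e) v k * (ln (v k) - ln (emp_weight k)))%:E.
  apply: ge_ereal_inf; eexists; first by exists (emp_measure Q), (emp_measure g).
  rewrite expectation_emp// EFinD EFinM leeD2l// lee_pmul2l ?lte_fin//.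
  exact: KL_reweight_le.
have UWfin : UW c beta (emp_measure P) (emp_measure e) \is a fin_num.
  rewrite ge0_fin_numE ?UW_ge0//; exact: le_lt_trans UWle (ltry _).
have Pdef : expectation_defined (emp_measure P) X.
  rewrite /expectation_defined fin_num_adde_defr//.
  rewrite (@integral_emp _ _ _ P _ (fun k => Num.max (X (xi k)) 0%R))//.
    by apply: measurable_funepos; exact/measurable_EFinP.
  by move=> k _; rewrite funeposE /= EFin_max.
apply: le_trans (PM _ Pdef).
rewrite /penalized_objective; case: eqP => [UWy|_].
  by move: UWfin; rewrite UWy.
rewrite expectation_emp//= leeBrDr ?fin_numM//.
apply: (@le_trans _ _ (((rho * beta) * ln Z)%:E + rho%:E *
   (\sum_(k : emp_idx e) v k * c (xi k, emp_atom k) +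
     beta * \sum_(k : emp_idx e) v k * (ln (v k) - ln (emp_weight k)))%:E)).
  by rewrite leeD2l// lee_pmul2l// lte_fin.
rewrite -EFinM -EFinD lee_fin -[X in (X + _)%R]mulr1 -v1 mulrDr mulrA !mulr_sumr.
rewrite -!big_split/=; apply: ler_sum => k _.
have := v0 k; rewrite le_eqVlt => /predU1P[<-|vk].
  by rewrite !(mul0r,mulr0,addr0).
have wk := vw k vk.
have -> : (ln (v k) = ln (emp_weight k) + F k / (rho * beta) - ln Z)%R.
  by rewrite ln_div ?posrE ?mulr_gt0 ?expR_gt0// lnM ?posrE ?expR_gt0// expRK.
(* The terms in [ln (emp_weight k)] and [ln Z] cancel, leaving [F k + rho * c (xi k, emp_atom k) = X
   (xi k)], weighted by [v k]. *)
rewrite /F le_eqVlt; apply/orP; left; apply/eqP.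
by field; rewrite !gt_eqF.
Qed.

(** The points [xi k] are chosen independently, so the suprema at all atoms are approached
    simultaneously. A finite [M] first forces them to be finite at atoms with mass; an [eps]
    argument follows. *)
Lemma strong_duality e (M : \bar R) :
  (forall P, expectation_defined P X ->
    penalized_objective X rho c beta (emp_measure e) P <= M) ->
  (rho * beta)%:E * lne (partition_function e) <= M.
Proof.
move=> PM; have bound xi := reweighted_bound e xi M PM.
case: M PM bound => [m| |] PM bound; last 2 first.
- by rewrite leey.
- by have := bound (@emp_atom _ _ _ e).
have boundm xi : (\sum_(k : emp_idx e) emp_weight k *
    expR ((X (xi k) - rho * c (xi k, emp_atom k)) / (rho * beta)) <=
    expR (m / (rho * beta)))%R.
  rewrite -ler_ln ?posrE ?expR_gt0 ?weighted_exp_gt0// expRK ler_pdivlMr//.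
  by rewrite mulrC -lee_fin; exact: bound.
have approx (y : emp_idx e -> R) :
    (forall k, (y k)%:E < penalized_sup X rho c (emp_atom k)) ->
    (\sum_(k : emp_idx e) emp_weight k * expR (y k / (rho * beta)) <=
     expR (m / (rho * beta)))%R.
  move=> yf.
  have /choice[xi xiP] (k : emp_idx e) :
      exists xi, (y k < X xi - rho * c (xi, emp_atom k))%R.
    by have [_ [xi _ <-]] := ereal_sup_gt (yf k); exists xi.
  apply: le_trans (boundm xi); apply: ler_sum => k _.
  rewrite ler_wpM2l ?emp_weight_ge0// ler_expR ler_pM2r ?invr_gt0//.
  exact: ltW.
(* For atoms without mass any real number below [f] will do. *)
pose low (k : emp_idx e) := (X (emp_atom k) - rho * c (emp_atom k, emp_atom k) - 1)%R.
have low_lt (k : emp_idx e) : (low k)%:E < penalized_sup X rho c (emp_atom k).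
  apply: lt_le_trans (penalized_sup_ge (emp_atom k) (emp_atom k)).
  by rewrite lte_fin ltrBlDr ltrDl.
have fin_atom (k : emp_idx e) : (0 < emp_weight k)%R ->
    penalized_sup X rho c (emp_atom k) != +oo.
  move=> wk; apply/eqP => fk.
  (* With this value the [k]th term alone is too large: by [expR t >= 1 + t] it is at least
     [emp_weight k + expR (m / (rho * beta)) + 1]. *)
  pose y j := if j == k then
    ((rho * beta) * ((expR (m / (rho * beta)) + 1) / emp_weight k))%R else low j.
  have /approx : forall j, (y j)%:E < penalized_sup X rho c (emp_atom j).
    by move=> j; rewrite /y; case: eqP => [->|_]; rewrite ?fk ?ltry.
  apply/negP; rewrite -ltNge (bigD1 k)//= {1}/y eqxx.
  rewrite mulrAC divff ?gt_eqF// mul1r; set t := (_ / emp_weight k)%R.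
  apply: (@lt_le_trans _ _ (emp_weight k * expR t)%R); last first.
    rewrite lerDl sumr_ge0// => j _.
    by rewrite mulr_ge0 ?emp_weight_ge0 ?expR_ge0.
  have H : (emp_weight k * (1 + t) <= emp_weight k * expR t)%R.
    by rewrite ler_pM2l// expR_ge1Dx.
  apply: lt_le_trans H; rewrite mulrDr mulr1 mulrCA divff ?gt_eqF// mulr1; lra.
pose phi (k : emp_idx e) := fine (penalized_sup X rho c (emp_atom k)).
have fE (k : emp_idx e) : (0 < emp_weight k)%R ->
    penalized_sup X rho c (emp_atom k) = (phi k)%:E.
  by move=> wk; rewrite fineK// fin_numElt penalized_sup_gtNy ltey fin_atom.
rewrite (partition_function_fin _ _ fE) lne_EFin ?weighted_exp_gt0// -EFinM.
rewrite lee_fin; apply/ler_addgt0Pr => eps eps0.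
rewrite mulrC -ler_pdivlMr// -ler_expR lnK ?posrE ?weighted_exp_gt0//.
(* Lowering [phi] by [eps] costs the factor [expR (- (eps / (rho * beta)))], which the slack in
   [m + eps] absorbs. *)
pose y k := if (0 < emp_weight k)%R then (phi k - eps)%R else low k.
have /approx : forall k, (y k)%:E < penalized_sup X rho c (emp_atom k).
  move=> k; rewrite /y; case: ifPn => // wk.
  by rewrite fE// lte_fin ltrBlDr ltrDl.
rewrite mulrDl expRD -ler_pdivrMr ?expR_gt0//; apply: le_trans.
rewrite -expRN mulr_suml; apply: ler_sum => k _; rewrite /y.
case: ifPn => wk; first by rewrite mulrBl expRD mulrA.
suff -> : emp_weight k = 0%R by rewrite !mul0r.
by apply/eqP; rewrite eq_le emp_weight_ge0 andbT leNgt.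
Qed.
End duality.

(** * Bound over the ambiguity ball and its value at the maximizer *)

Theorem proposition2 (R : realType) (d : measure_display)
    (Xi : measurableType d) (Theta : Type)
    (N : nat) (Phat : 'I_N -> empirical Xi R)
    (beta : R) (hbeta : (0 < beta)%R)
    (L : Theta -> Xi -> R) (mL : forall t, measurable_fun [set: Xi] (L t))
    (c : Xi * Xi -> R) (mc : measurable_fun [set: Xi * Xi] c)
    (c_ge0 : forall p, (0 <= c p)%R)
    (theta : Theta) (rho : R) (hrho : (0 < rho)%R)
    (lam : 'I_N -> R) (lam_ge0 : forall i, (0 <= lam i)%R)
    (lam_sum1 : (\sum_(i < N) lam i = 1)%R)
    (Pstar : probability Xi R) :
  let Plam : empirical Xi R := emp_mixture lam_ge0 lam_sum1 Phat in
  let Q : probability Xi R := emp_measure Plam in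
  penalized_maximizer (L theta) rho c beta Q Pstar ->
  let rhat : \bar R := UW c beta Pstar Q in
  let V : \bar R := rho%:E * rhat + (rho * beta)%:E *
    lne (emp_expectation Plam (fun zeta =>
      expeR (penalized_sup (L theta) rho c zeta * ((rho * beta)^-1)%:E))) in
  ereal_sup [set 'E_P[L theta] | P in [set P : probability Xi R |
      expectation_defined P (L theta) /\ UW c beta P Q <= rhat]] <= V
  /\ V = 'E_Pstar[L theta].
Proof.
move=> Plam Q [_ Pstar_max] rhat V.
have VE : V = rho%:E * rhat +
  (rho * beta)%:E * lne (partition_function (L theta) c rho beta Plam) by [].
have weak P : 'E_P[L theta] <= rho%:E * UW c beta P Q +
    (rho * beta)%:E * lne (partition_function (L theta) c rho beta Plam).
  by apply: weak_duality => //; exact: mL.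
have rhat_ge0 : 0 <= rhat by exact: UW_ge0.
split.
  apply: ge_ereal_sup => _ [P [_ Pr] <-]; apply: (le_trans (weak P)).
  by rewrite VE leeD2r// lee_pmul2l// lte_fin.
(* One inequality is weak duality at [Pstar], the other strong duality with [M] the optimal
   objective. *)
apply/eqP; rewrite eq_le weak andbT VE.
have := strong_duality _ _ _ _ (mL theta) mc c_ge0 hrho hbeta Plam _ Pstar_max.
(* A real lower bound on the optimal objective excludes [-oo], hence [rhat = +oo]; the subtraction
   can then be undone. *)
have := reweighted_bound _ _ _ _ (mL theta) mc c_ge0 hrho hbeta Plam
  (@emp_atom _ _ _ Plam) _ Pstar_max.
rewrite /penalized_objective; case: eqP => [//|/eqP rhat_fin] _.
have fin : rho%:E * rhat \is a fin_num.
  by rewrite fin_numM// ge0_fin_numE// ltey.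
by rewrite leeBrDr// addeC.
Qed.
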